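(* Let $m \ge r \ge 2$ be integers and let $F$ be an $r$-graph with $m$ vertices. Suppose that $F$ is $(c_1,c_2)$-bounded for some real numbers $c_1 < 1/m$ and $c_2 > 0$, and set $$\delta := \min\left\{\frac{1}{4}\left(\frac{1}{m}-c_1\right),\ \frac{c_2}{4}\right\}.$$ Then there is $n_0$ such that for every $n \ge n_0$ and every integer $t$ with $$0 \le t \le \min\left\{\frac{\delta\cdot \mathrm{ex}(n,F)}{m\binom{n-1}{r-1}},\ \frac{\delta(n-1)}{8m(r-1)}\right\},$$ we have $$\mathrm{EX}\left(n,(t+1)F\right) = K_t^r \mathbin{\bowtie} \mathrm{EX}(n-t,F),$$ i.e. (up to isomorphism) the $n$-vertex $r$-graphs with at most $t$ pairwise vertex-disjoint copies of $F$ and the maximum possible number of edges are exactly the $r$-graphs $K_t^r \mathbin{\bowtie} \mathcal{G}$ with $\mathcal{G} \in \mathrm{EX}(n-t,F)$.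
   Context: An $r$-graph is a set of $r$-element subsets (edges) of a finite vertex set; $|\mathcal{H}|$ denotes its number of edges, $d_{\mathcal{H}}(v)$ the number of edges containing $v$, and $\Delta(\mathcal{H})$ the maximum degree. $\mathcal{H}$ is $F$-free if it contains no copy of $F$ as a (not necessarily induced) subgraph. $\mathrm{ex}(n,F)$ is the maximum number of edges in an $n$-vertex $F$-free $r$-graph, and $\mathrm{EX}(n,F)$ is the set of $n$-vertex $F$-free $r$-graphs with exactly $\mathrm{ex}(n,F)$ edges. For an integer $t\ge 0$, $\mathrm{ex}(n,(t+1)F)$ denotes the maximum number of edges in an $n$-vertex $r$-graph that does not contain $t+1$ pairwise vertex-disjoint copies of $F$, and $\mathrm{EX}(n,(t+1)F)$ is the set of such $r$-graphs attaining this maximum. $K_t^r$ is the complete $r$-graph on $t$ vertices. For $r$-graphs $\mathcal{G},\mathcal{H}$ on disjoint vertex sets, the join $\mathcal{G}\mathbin{\bowtie}\mathcal{H}$ is obtained from the disjoint union of $\mathcal{G}$ and $\mathcal{H}$ by adding all $r$-sets meeting both $V(\mathcal{G})$ and $V(\mathcal{H})$; for a family $\mathcal{F}$, $\mathcal{H}\mathbin{\bowtie}\mathcal{F} := \{\mathcal{H}\mathbin{\bowtie}\mathcal{G} : \mathcal{G}\in\mathcal{F}\}$. Boundedness: for reals $c_1,c_2>0$, an $r$-graph $F$ is $(c_1,c_2)$-bounded if there is $N$ such that for all $n \ge N$, every $n$-vertex $r$-graph $\mathcal{H}$ with $\Delta(\mathcal{H}) \ge c_1\binom{n-1}{r-1}$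 and $|\mathcal{H}| \ge (1-c_2)\,\mathrm{ex}(n,F)$ contains a copy of $F$. *)

(* Defs.v *)
From HB Require Import structures.
From mathcomp Require Import all_boot all_order all_algebra.
From mathcomp Require Import reals.

Import Order.TTheory GRing.Theory Num.Theory.
Local Open Scope ring_scope.

Definition uniform (V : finType) (r : nat) (H : {set {set V}}) : bool :=
  [forall e in H, #|e| == r]%N.
Arguments uniform {V} r H.

Definition has_copy (m : nat) (V : finType) (F : {set {set 'I_m}})
    (H : {set {set V}}) : bool :=
  [exists f : {ffun 'I_m -> V}, injectiveb f && [forall e in F, (f @: e) \in H]].
Arguments has_copy {m V} F H.

Definition has_disj_copies (k m : nat) (V : finType) (F : {set {set 'I_m}})
    (H : {set {set V}}) : bool :=
  [exists g : {ffun 'I_k -> {ffun 'I_m -> V}},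
     [forall i, injectiveb (g i) && [forall e in F, (g i @: e) \in H]] &&
     [forall i, forall j, (i != j) ==> [disjoint (g i @: setT) & (g j @: setT)]]].
Arguments has_disj_copies k {m V} F H.

Definition ex (r n m : nat) (F : {set {set 'I_m}}) : nat :=
  \max_(H : {set {set 'I_n}} | uniform r H && ~~ has_copy F H) #|H|.
Arguments ex r n {m} F.

Definition exk (r n k m : nat) (F : {set {set 'I_m}}) : nat :=
  \max_(H : {set {set 'I_n}} | uniform r H && ~~ has_disj_copies k F H) #|H|.
Arguments exk r n k {m} F.

Definition isEX (r n m : nat) (F : {set {set 'I_m}}) (H : {set {set 'I_n}}) : bool :=
  [&& uniform r H, ~~ has_copy F H & #|H| == ex r n F].
Arguments isEX r {n m} F H.

Definition isEXk (r n k m : nat) (F : {set {set 'I_m}}) (H : {set {set 'I_n}}) : bool :=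
  [&& uniform r H, ~~ has_disj_copies k F H & #|H| == exk r n k F].
Arguments isEXk r {n} k {m} F H.

Definition maxdeg (V : finType) (H : {set {set V}}) : nat :=
  \max_(v : V) #|[set e in H | v \in e]|.
Arguments maxdeg {V} H.

Definition bounded (R : realType) (r m : nat) (F : {set {set 'I_m}}) (c1 c2 : R) : Prop :=
  exists N : nat, forall n : nat, (N <= n)%N ->
    forall H : {set {set 'I_n}}, uniform r H ->
      c1 * ('C(n.-1, r.-1))%:R <= (maxdeg H)%:R ->
      (1 - c2) * (ex r n F)%:R <= (#|H|)%:R ->
      has_copy F H.
Arguments bounded {R} r {m} F c1 c2.

Definition joinK (r t k : nat) (G : {set {set 'I_k}}) : {set {set ('I_t + 'I_k)%type}} :=
  [set e : {set ('I_t + 'I_k)%type} | (#|e| == r) &&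
     (~~ (e \subset [set inr x | x : 'I_k]) || ([set x | inr x \in e] \in G))].
Arguments joinK r t {k} G.

Definition isomorphic (V1 V2 : finType) (H1 : {set {set V1}}) (H2 : {set {set V2}}) : Prop :=
  exists f : V1 -> V2, bijective f /\ H2 = [set f @: e | e : {set V1} in H1].
Arguments isomorphic {V1 V2} H1 H2.

(* Main.v *)
Require Import Defs.
From HB Require Import structures.
From mathcomp Require Import all_boot all_order all_algebra.
From mathcomp Require Import reals.
From mathcomp Require Import zify lra.
Import Order.TTheory GRing.Theory Num.Theory.
Local Open Scope ring_scope.

(**
Let H be extremal without t+1 disjoint copies of F, and call a vertex heavy if
its degree is at least (c1 + delta) C(n-1, r-1).  Deleting up to m t vertices
from H keeps a heavy vertex of degree at least c1 C(n-1, r-1) and keeps most of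
the edges, so boundedness still yields a copy of F.  Hence any packing that
avoids a set of heavy vertices can be enlarged by one copy per heavy vertex; in
particular there are at most t heavy vertices, and a maximal packing of light
vertices has at most t - #heavy copies.  If d = t - #heavy were positive,
counting edges would give
  d C(n-t, r-1) <= m d (c1 + delta) C(n-1, r-1),
where boundedness enters once more through ex(n+1) - ex(n) <= c1 C(n, r-1); as
m (c1 + delta) <= 1 - 3 m delta this is impossible for t small compared to n.
So there are exactly t heavy vertices and the rest of H is F-free; comparison
with the join construction shows that H is itself such a join.
*)


(** * Induced subgraphs, degrees and codegrees *)

Section Induced.
Local Open Scope nat_scope.
Context {V : finType}.
Implicit Types (H : {set {set V}}) (S L B : {set V}) (v : V).

Definition induced H S : {set {set V}} := [set e in H | e \subset S].

Definition deg H v : nat := #|[set e in H | v \in e]|.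

Lemma uniformP r H : reflect {in H, forall e : {set V}, #|e| = r} (uniform r H).
Proof. exact: 'forall_in_eqP. Qed.

Lemma induced_setT H : induced H setT = H.
Proof. by apply/setP=> e; rewrite !inE subsetT andbT. Qed.

(** An edge lost when [B] is deleted contains a vertex of [B], so the degrees over [B] count every
    loss. *)
Lemma card_induced_le_sum H S B :
  #|induced H S| <= #|induced H (S :\: B)| + \sum_(v in B) deg H v.
Proof.
have sub : induced H S \subset
    induced H (S :\: B) :|: \bigcup_(v in B) [set e in H | v \in e].
  apply/subsetP=> e; rewrite !inE => /andP[eH eS]; rewrite eH /=.
  rewrite subsetD eS /=; case: (boolP [disjoint e & B]) => //= /pred0Pn[v /andP[ve vB]].
  by apply/bigcupP; exists v => //; rewrite inE eH.
apply: leq_trans (subset_leq_card sub) _.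
apply: leq_trans (leq_card_setU _ _) _; rewrite leq_add2l.
elim/big_ind2: _ => [|A1 n1 A2 n2 h1 h2|//]; first by rewrite cards0.
by apply: leq_trans (leq_card_setU _ _) (leq_add h1 h2).
Qed.

Lemma card_induced_leD H S B D : {in B, forall v, deg H v <= D} ->
  #|induced H S| <= #|induced H (S :\: B)| + #|B| * D.
Proof.
move=> degD; apply: leq_trans (card_induced_le_sum H S B) _.
by rewrite leq_add2l -sum_nat_const leq_sum.
Qed.

(** Removing [A] is injective on the edges containing [A]. Sets [A] of size 1 and 2 give the degree
    and codegree bounds. *)
Lemma card_link_le r H (A : {set V}) : uniform r H ->
  #|[set e in H | A \subset e]| <= 'C(#|V| - #|A|, r - #|A|).
Proof.
move=> /uniformP u; have <- : #|~: A| = #|V| - #|A| by rewrite cardsCs setCK.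
rewrite -cards_draws.
rewrite -(@card_in_imset _ _ (fun e : {set V} => e :\: A) [set e in H | A \subset e]); last first.
  move=> e1 e2; rewrite !inE => /andP[_ s1] /andP[_ s2] eqD.
  by rewrite -(setID e1 A) -(setID e2 A) eqD (setIidPr s1) (setIidPr s2).
apply/subset_leq_card/subsetP=> _ /imsetP[e /[!inE] /andP[eH Ae] ->].
by rewrite subsetDr cardsDS // (u _ eH) eqxx.
Qed.

Lemma deg_le r H v : uniform r H -> deg H v <= 'C(#|V|.-1, r.-1).
Proof.
move=> u; have := card_link_le r H [set v] u.
rewrite cards1 !subn1; apply: leq_trans.
by apply/subset_leq_card/subsetP=> e; rewrite !inE sub1set.
Qed.

Lemma codeg_le r H u v : uniform r H -> u != v ->
  deg [set e in H | v \in e] u <= 'C(#|V|.-2, r.-2).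
Proof.
move=> uH uv; have := card_link_le r H [set u; v] uH.
rewrite cards2 uv !subn2; apply: leq_trans.
by apply/subset_leq_card/subsetP=> e; rewrite !inE subUset !sub1set andbAC -andbA.
Qed.

Lemma deg_induced_ge r H B v : uniform r H -> v \notin B ->
  deg H v <= deg (induced H (~: B)) v + #|B| * 'C(#|V|.-2, r.-2).
Proof.
move=> uH vB; have := card_induced_leD [set e in H | v \in e] setT B 'C(#|V|.-2, r.-2).
rewrite induced_setT setTD => /(_ _)/leq_trans; apply.
  by move=> u uB; apply: (codeg_le r) => //; apply: contraNneq vB => <-.
by rewrite leq_add2r; apply/subset_leq_card/subsetP=> e; rewrite !inE andbAC.
Qed.

(** Edges of [H] not inside [S] are among all [r]-sets not inside [S]; the additive form avoids
    truncated subtraction. *)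
Lemma card_meeting_le r H S : uniform r H ->
  #|H| + 'C(#|S|, r) <= 'C(#|V|, r) + #|induced H S|.
Proof.
move=> /uniformP u; rewrite -cards_draws -card_draws.
rewrite -(cardsID (induced H S) H) (setIidPr _); last by apply/subsetP=> e /[!inE] /andP[].
rewrite -addnA [leqRHS]addnC leq_add2l.
rewrite -cardsUI (_ : _ :&: _ = set0) ?cards0 ?addn0; last first.
  by apply/setP=> e; rewrite !inE; case: (e \in H); case: (e \subset S).
apply/subset_leq_card/subsetP=> e; rewrite !inE => /orP[/andP[_ /u->//]|/andP[]//].
Qed.

End Induced.

(** * Copies of [F] and packings of disjoint copies *)

Section Copies.
Local Open Scope nat_scope.
Context {m : nat} (F : {set {set 'I_m}}).

Section OneGraph.
Context {V : finType}.
Implicit Types (H : {set {set V}}) (S : {set V}) (f : {ffun 'I_m -> V}).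

Definition is_copy H f : bool :=
  injectiveb f && [forall e in F, (f @: e) \in H].

Definition has_copy_in H S : bool :=
  [exists f : {ffun 'I_m -> V}, is_copy H f && (f @: setT \subset S)].

Lemma has_copyE H : has_copy F H = has_copy_in H setT.
Proof. by apply: eq_existsb => f; rewrite subsetT andbT. Qed.

Lemma has_copy_in_sub H S1 S2 : S1 \subset S2 -> has_copy_in H S1 -> has_copy_in H S2.
Proof.
move=> s12 /existsP[f /andP[cf fS]]; apply/existsP; exists f.
by rewrite cf (subset_trans fS).
Qed.

(* Only isolated vertices of F can leave S, and they can be moved back into S one at a time. *)
Lemma has_copy_in_support H S : m <= #|S| -> {in H, forall e : {set V}, e \subset S} ->
  has_copy_in H setT -> has_copy_in H S.
Proof.
move=> mS HS /existsP[f /andP[cf _]].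
have [k] := ubnP #|[set i | f i \notin S]|; elim: k f cf => // k IHk f cf.
have /andP[/injectiveP injf /forall_inP Ff] := cf.
have [S0|[i]] := set_0Vmem [set i | f i \notin S].
  move=> _; apply/existsP; exists f; rewrite cf; apply/subsetP=> _ /imsetP[i _ ->].
  by move/setP/(_ i): S0; rewrite !inE => /negbFE.
rewrite inE ltnS => iS ltk.
(* The image of [f] has [m] elements, at most as many as [S], and one of them lies outside [S]; so
   it misses some vertex of [S], to which [i] is rerouted. *)
have [s sS sf] : exists2 s, s \in S & s \notin f @: setT.
  apply/subsetPn; apply: contraNN iS => Sf.
  have /eqP<- : f @: setT == S.
    by rewrite eq_sym eqEcard Sf (leq_trans _ mS) // card_imset // cardsT card_ord.
  exact: imset_f.
have fNs j : f j <> s by move=> fj; rewrite -fj imset_f in sf.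
pose f' := [ffun j => if j == i then s else f j].
apply: (IHk f'); last first.
  apply: leq_trans _ ltk; apply: proper_card; apply/properP; split.
    by apply/subsetP=> j; rewrite !inE ffunE; case: eqP => // _; rewrite sS.
  by exists i; rewrite !inE ?ffunE ?eqxx ?sS.
apply/andP; split.
  apply/injectiveP=> j1 j2; rewrite !ffunE.
  case: eqP => [->|_]; case: eqP => [->|_] //.
  - by move/esym/fNs.
  - by move/fNs.
  - exact: injf.
apply/forall_inP=> e eF; rewrite (_ : f' @: e = f @: e) ?Ff //.
apply: eq_in_imset => j je; rewrite ffunE; case: eqP => // ji; case/negP: iS.
by rewrite -ji; apply: (subsetP (HS _ (Ff _ eF))); apply: imset_f.
Qed.

(** A list, so that a packing can grow by one copy at a time. *)
Definition packing H (s : seq {ffun 'I_m -> V}) : bool :=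
  all (is_copy H) s &&
  pairwise (fun f g : {ffun 'I_m -> V} => [disjoint f @: setT & g @: setT]) s.

Definition covered (s : seq {ffun 'I_m -> V}) : {set V} :=
  \bigcup_(f <- s) (f @: setT).

Lemma covered_cons f s : covered (f :: s) = f @: setT :|: covered s.
Proof. by rewrite /covered big_cons. Qed.

Lemma card_covered s : #|covered s| <= m * size s.
Proof.
elim: s => [|f s IHs]; first by rewrite /covered big_nil cards0.
rewrite covered_cons mulnS; apply: leq_trans (leq_card_setU _ _) (leq_add _ IHs).
by apply: leq_trans (leq_imset_card _ _) _; rewrite cardsT card_ord.
Qed.

Lemma packing_cons H f s : is_copy H f -> [disjoint f @: setT & covered s] ->
  packing H s -> packing H (f :: s).
Proof.
move=> cf dis /andP[cs ps]; rewrite /packing /= cf cs ps /= andbT.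
elim: s dis {cs ps} => //= g s IHs; rewrite covered_cons -setI_eq0 setIUr setU_eq0.
by rewrite !setI_eq0 => /andP[-> /IHs].
Qed.

Lemma packing_has_disj_copies H s : packing H s -> has_disj_copies (size s) F H.
Proof.
case/andP=> /allP cs ps; apply/existsP.
exists [ffun i => tnth (in_tuple s) i]; apply/andP; split.
  by apply/forallP=> i; rewrite ffunE; apply: cs; apply: mem_tnth.
apply/forallP=> i; apply/forallP=> j; apply/implyP.
have f := tnth (in_tuple s) i.
have lt_dis (a b : 'I_(size s)) : a < b ->
    [disjoint (tnth (in_tuple s) a) @: setT & (tnth (in_tuple s) b) @: setT].
  move=> ab; rewrite !(tnth_nth f) /=.
  by move/(pairwiseP f): ps; apply=> //; rewrite inE.
rewrite !ffunE neq_ltn => /orP[/lt_dis//|/lt_dis].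
by rewrite disjoint_sym.
Qed.

Lemma has_disj_copies_has_copy k H : has_disj_copies k.+1 F H -> has_copy F H.
Proof.
case/existsP=> g /andP[/forallP/(_ ord0) cg _].
by apply/existsP; exists (g ord0).
Qed.

End OneGraph.

(** * Transport along injections of vertex sets *)

Section Pull.
Context {W V : finType} (phi : W -> V) (phi_inj : injective phi).
Implicit Types (H : {set {set V}}).

(** The subgraph induced on the image of [phi], renamed to live on [W]; with [W] an ordinal, [ex]
    and boundedness apply to it. *)
Definition pull H : {set {set W}} := [set e : {set W} | phi @: e \in H].

Lemma pull_uniform r H : uniform r H -> uniform r (pull H).
Proof.
move=> /uniformP u; apply/uniformP=> e; rewrite inE => /u <-.
by rewrite card_imset.
Qed.

Lemma pull_has_copy H : has_copy F (pull H) = has_copy_in H (phi @: setT).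
Proof.
apply/existsP/existsP=> -[f].
  case/andP=> /injectiveP injf /forall_inP Ff; exists [ffun i => phi (f i)].
  have fE (e : {set 'I_m}) : [ffun i => phi (f i)] @: e = phi @: (f @: e).
    by rewrite -imset_comp; apply: eq_imset => i; rewrite ffunE.
  rewrite fE imsetS ?subsetT // andbT; apply/andP; split.
    by apply/injectiveP=> i j; rewrite !ffunE => /phi_inj/injf.
  by apply/forall_inP=> e /Ff; rewrite inE fE.
case/andP=> /andP[/injectiveP injf /forall_inP Ff] /subsetP fS.
have /fin_all_exists[g gE] i : exists w, phi w = f i.
  by have /imsetP[w _ ->] := fS _ (imset_f f (in_setT i)); exists w.
exists [ffun i => g i]; apply/andP; split.
  by apply/injectiveP=> i j; rewrite !ffunE => /(congr1 phi); rewrite !gE => /injf.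
apply/forall_inP=> e /Ff; rewrite inE -imset_comp.
by congr (_ \in H); apply: eq_imset => i /=; rewrite ffunE gE.
Qed.

Lemma imset_preim (e : {set V}) : e \subset phi @: setT -> phi @: (phi @^-1: e) = e.
Proof.
move=> sub; apply/setP=> v; apply/imsetP/idP => [[w /[!inE] we ->]//|ve].
by have /imsetP[w _ vE] := subsetP sub v ve; exists w => //; rewrite inE -vE.
Qed.

Lemma preim_imset (e : {set W}) : phi @^-1: (phi @: e) = e.
Proof. by apply/setP=> w; rewrite inE mem_imset. Qed.

Lemma card_pull H : #|pull H| = #|induced H (phi @: setT)|.
Proof.
rewrite -(card_imset _ (imset_inj phi_inj)); apply: eq_card => e.
apply/imsetP/idP => [[e' /[!inE] eH ->]|/[!inE] /andP[eH eS]].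
  by rewrite eH imsetS ?subsetT.
by exists (phi @^-1: e); rewrite ?inE imset_preim.
Qed.

Lemma deg_pull H w : deg (pull H) w = deg (induced H (phi @: setT)) (phi w).
Proof.
have -> : deg (pull H) w = #|pull [set e in H | phi w \in e]|.
  by apply: eq_card => e; rewrite !inE mem_imset.
by rewrite card_pull; apply: eq_card => e; rewrite !inE andbAC.
Qed.

End Pull.

Lemma enum_val_imset {V : finType} (S : {set V}) :
  (enum_val : 'I_#|S| -> V) @: setT = S.
Proof.
apply/setP=> v; apply/imsetP/idP => [[i _ ->]|vS]; first exact: enum_valP.
by exists (enum_rank_in vS v); rewrite ?inE ?enum_rankK_in.
Qed.

(** * Turan numbers *)

Section Turan.
Context (r : nat).

Lemma free_card_le {V : finType} (H : {set {set V}}) (S : {set V}) :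
  uniform r H -> ~~ has_copy_in H S -> #|induced H S| <= ex r #|S| F.
Proof.
move=> uH; rewrite -{1 2}(enum_val_imset S) -card_pull; last exact: enum_val_inj.
rewrite -pull_has_copy; last exact: enum_val_inj.
move=> free; apply: (bigop.bigmax_sup (pull enum_val H)) => //.
by rewrite free pull_uniform //; apply: enum_val_inj.
Qed.

(** [H0] makes the family of competitors nonempty; over an empty family [ex] would be 0 by default
    and not attained. *)
Lemma ex_attained {n : nat} (H0 : {set {set 'I_n}}) :
  uniform r H0 -> ~~ has_copy F H0 -> exists H : {set {set 'I_n}}, isEX r F H.
Proof.
move=> u0 f0; have P0 : uniform r H0 && ~~ has_copy F H0 by rewrite u0.
rewrite /isEX /ex (bigop.bigmax_eq_arg H0) //.
case: arg_maxnP => // H /andP[u f] _; by exists H; rewrite u f eqxx.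
Qed.

Lemma ex_gt0_attained n : 0 < ex r n F -> exists H : {set {set 'I_n}}, isEX r F H.
Proof.
move=> ex_gt0; have [/existsP[H /andP[u f]]|] :=
  boolP [exists H : {set {set 'I_n}}, uniform r H && ~~ has_copy F H].
  exact: (ex_attained H).
rewrite negb_exists => /forallP none; move: ex_gt0.
by rewrite /ex big_pred0 // => H; apply: negbTE.
Qed.

(** Isolated vertices are added to an extremal graph. A copy of [F] in the larger graph could be
    moved back to the old vertices, where [m <= n1] provides the room. *)
Lemma ex_mono n1 n2 : m <= n1 -> n1 <= n2 -> ex r n1 F <= ex r n2 F.
Proof.
move=> mn1 n12; case: (posnP (ex r n1 F)) => [->//|/ex_gt0_attained[G]].
case/and3P=> /uniformP uG fG /eqP <-.
have wi : injective (widen_ord n12) by move=> i j /(congr1 val) /= /val_inj.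
pose H := [set widen_ord n12 @: (e : {set _}) | e in G].
have cardS : #|widen_ord n12 @: setT| = n1 by rewrite card_imset // cardsT card_ord.
rewrite -(card_imset _ (imset_inj wi)) -/H.
apply: (bigop.bigmax_sup H) => //; apply/andP; split.
  by apply/uniformP=> _ /imsetP[e eG ->]; rewrite card_imset ?uG.
have pullH : pull (widen_ord n12) H = G.
  by apply/setP=> e; rewrite inE mem_imset //; apply: imset_inj.
rewrite -pullH pull_has_copy // in fG; apply: contraNN fG; rewrite has_copyE.
apply: has_copy_in_support; first by rewrite cardS.
by move=> _ /imsetP[e _ ->]; rewrite imsetS ?subsetT.
Qed.

End Turan.
End Copies.


(** * Joins with a complete graph *)

Section Join.
Local Open Scope nat_scope.
Context (r : nat).

(* The image of phi carries G; the other vertices of V play the role of K_t. *)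
Definition join_along {W V : finType} (phi : W -> V) (G : {set {set W}}) : {set {set V}} :=
  [set e : {set V} | (#|e| == r) && (~~ (e \subset phi @: setT) || (phi @^-1: e \in G))].

Section JoinAlong.
Context {W V : finType} (phi : W -> V) (phi_inj : injective phi).
Implicit Types (G : {set {set W}}) (H : {set {set V}}).

Lemma join_along_uniform G : uniform r (join_along phi G).
Proof. by apply/uniformP=> e; rewrite inE => /andP[/eqP]. Qed.

Lemma sub_join_along_pull H : uniform r H -> H \subset join_along phi (pull phi H).
Proof.
move=> /uniformP u; apply/subsetP=> e eH; rewrite inE u // eqxx /=.
by case: (boolP (e \subset _)) => //= sub; rewrite inE imset_preim.
Qed.

Lemma pull_join_along G : uniform r G -> pull phi (join_along phi G) = G.
Proof.
move=> /uniformP u; apply/setP=> e; rewrite !inE imsetS ?subsetT //= preim_imset //.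
by rewrite card_imset //; case: (boolP (e \in G)) => [/u->|_]; rewrite ?eqxx ?andbF.
Qed.

(** The join consists of all [r]-sets not inside the image of [phi] and a copy of [G] inside it. *)
Lemma card_join_along G : uniform r G ->
  #|join_along phi G| + 'C(#|W|, r) = 'C(#|V|, r) + #|G|.
Proof.
move=> uG; have cW : #|phi @: setT| = #|W| by rewrite card_imset // cardsT.
have cG : #|induced (join_along phi G) (phi @: setT)| = #|G|.
  by rewrite -card_pull // pull_join_along.
rewrite -(cardsID (induced (join_along phi G) (phi @: setT)) (join_along phi G)).
rewrite (setIidPr _) ?cG; last by apply/subsetP=> e /[!inE] /andP[].
rewrite -cW -cards_draws -card_draws -addnA [RHS]addnC; congr (_ + _).
rewrite addnC -(cardsID [set A : {set V} | (A \subset phi @: setT) & (#|A| == r)]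
                  [set A : {set V} | #|A| == r]).
congr (_ + _); apply: eq_card => e; rewrite !inE; first by case: (#|e| == r); rewrite ?andbF ?andbT.
by case: (#|e| == r); case: (e \subset _); rewrite ?andbF ?andbT //=; case: (_ \in G).
Qed.

(* Each copy of F must use a vertex outside the image of phi. *)
Lemma join_along_free {m : nat} (F : {set {set 'I_m}}) G k :
  uniform r G -> ~~ has_copy F G -> #|~: (phi @: setT)| < k ->
  ~~ has_disj_copies k F (join_along phi G).
Proof.
move=> uG fG; apply: contraTN => /existsP[g /andP[/forallP cg /forallP dg]].
have /fin_all_exists[x /all_and2[xg xS]] (i : 'I_k) :
    exists x, x \in g i @: setT /\ x \in ~: (phi @: setT).
  have : ~~ (g i @: setT \subset phi @: setT).
    apply: contraNN fG => sub; rewrite -(pull_join_along G uG) pull_has_copy //.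
    by apply/existsP; exists (g i); rewrite [is_copy _ _ _]cg.
  by case/subsetPn=> x xg xS; exists x; rewrite inE xg xS.
have x_inj : injective x.
  move=> i j xij; apply/eqP; apply: contraT => ij.
  have /pred0P/(_ (x i)) := implyP (forallP (dg i) j) ij.
  by rewrite /= xg xij xg.
rewrite -leqNgt -[k]card_ord -cardsT -(card_imset _ x_inj).
by apply/subset_leq_card/subsetP=> _ /imsetP[i _ ->].
Qed.

End JoinAlong.

Lemma imset_joinK {V : finType} (t k : nat) (f : 'I_t + 'I_k -> V) (G : {set {set 'I_k}}) :
  bijective f ->
  [set f @: (e : {set _}) | e in joinK r t G] = join_along (fun x => f (inr x)) G.
Proof.
move=> fbij; have f_inj := bij_inj fbij; have [h fK hK] := fbij.
have fT : f @: setT = setT by apply/setP=> v; rewrite inE -(hK v) imset_f.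
have fpre (e : {set V}) : f @: (f @^-1: e) = e by rewrite imset_preim // fT subsetT.
apply/setP=> e; rewrite -[e in LHS]fpre mem_imset; last exact: imset_inj.
rewrite !inE -(card_imset _ f_inj) fpre; congr (_ && (~~ _ || _)).
  apply/subsetP/subsetP => sub v.
    move=> ve; have /imsetP[x _ vx] : h v \in [set inr x | x : 'I_k].
      by apply: sub; rewrite inE hK.
    by rewrite -(hK v) vx; apply/imsetP; exists x.
  rewrite inE => /sub/imsetP[x _ /f_inj ->]; exact: imset_f.
by congr (_ \in G); apply/setP=> x; rewrite !inE.
Qed.

(** Conversely to restriction, an injection [phi] misses exactly [t] vertices, and enumerating them
    extends it to a bijection from the sum type. *)
Lemma isomorphic_joinK {V : finType} (t k : nat) (G : {set {set 'I_k}}) (H : {set {set V}}) :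
  #|V| = t + k ->
  isomorphic (joinK r t G) H <->
  exists phi : 'I_k -> V, injective phi /\ H = join_along phi G.
Proof.
move=> cV; split=> [[f [fbij ->]]|[phi [phi_inj ->]]].
  exists (fun x => f (inr x)); split; last exact: imset_joinK.
  by move=> x y /(bij_inj fbij) [].
have cS : t = #|~: (phi @: setT)|.
  by rewrite cardsCs setCK card_imset // cardsT card_ord cV addnK.
pose f (x : 'I_t + 'I_k) := match x with
  | inl i => enum_val (cast_ord cS i) | inr j => phi j end.
have f_inl i : f (inl i) \notin phi @: setT by have := enum_valP (cast_ord cS i); rewrite inE.
have f_bij : bijective f.
  apply: inj_card_bij; last by rewrite cV card_sum !card_ord.
  move=> [i|j] [i'|j'] ff.
  - by move/enum_val_inj/cast_ord_inj: ff => ->.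
  - by have := f_inl i; rewrite ff (imset_f phi).
  - by have := f_inl i'; rewrite -ff (imset_f phi).
  - by move/phi_inj: ff => ->.
by exists f; split; rewrite ?imset_joinK.
Qed.

End Join.

(** * Binomial estimates *)

Section Binomial.
Local Open Scope nat_scope.

Lemma bin_addn_ge a d s : 'C(a, s.+1) + d * 'C(a, s) <= 'C(a + d, s.+1).
Proof.
elim: d => [|d IHd]; first by rewrite addn0 mul0n addn0.
rewrite addnS binS mulSn addnCA addnC leq_add // leq_bin2l ?leq_addr //.
Qed.

Lemma bin_addn_le a d s : 'C(a + d, s.+1) <= 'C(a, s.+1) + d * 'C((a + d).-1, s).
Proof.
elim: d => [|d IHd]; first by rewrite addn0 mul0n addn0.
rewrite addnS binS mulSn /= addnCA addnC leq_add2l (leq_trans IHd) // leq_add2l.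
by rewrite leq_mul2l leq_bin2l ?leq_pred ?orbT.
Qed.

End Binomial.


Ltac lia_nat :=
  repeat match goal with
  | H : ?T |- _ => lazymatch type of T with Prop =>
      lazymatch T with
      | is_true (leq _ _) => fail
      | @eq nat _ _ => fail
      | _ => clear H
      end end
  end; lia.

(** * Consequences of boundedness *)

Section Bounded.
Context {R : realType} {m r : nat} (F : {set {set 'I_m}}) {c1 c2 : R} (N : nat).
Hypothesis c1_ge0 : 0 <= c1.
Hypothesis c2_gt0 : 0 < c2.
Hypothesis bdd : forall n : nat, (N <= n)%N ->
  forall H : {set {set 'I_n}}, uniform r H ->
    c1 * ('C(n.-1, r.-1))%:R <= (maxdeg H)%:R ->
    (1 - c2) * (ex r n F)%:R <= (#|H|)%:R ->
    has_copy F H.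

(** An extremal graph on [n.+1] vertices has enough edges but no copy of [F], so boundedness keeps
    its degrees below [c1 * 'C(n, r.-1)]; one vertex is deleted. *)
Lemma ex_succ_le n : (N <= n.+1)%N ->
  (ex r n.+1 F)%:R <= (ex r n F)%:R + c1 * 'C(n, r.-1)%:R.
Proof.
move=> Nn; case: (posnP (ex r n.+1 F)) => [->|/ex_gt0_attained[H]].
  by rewrite addr_ge0 ?mulr_ge0 ?ler0n.
case/and3P=> uH fH /eqP cH.
have maxdeg_lt : (maxdeg H)%:R < c1 * 'C(n, r.-1)%:R.
  rewrite ltNge; apply: contraNN fH => big; apply: (bdd n.+1) => //.
  by rewrite cH mulrBl mul1r gerBl mulr_ge0 ?ler0n // ltW.
have degH : {in [set ord0], forall v, deg H v <= maxdeg H}%N.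
  by move=> v _; exact: (bigop.bigmax_sup v).
have := card_induced_leD H setT _ _ degH.
rewrite induced_setT setTD cards1 mul1n cH -(ler_nat R) natrD => /le_trans; apply.
apply: lerD (ltW maxdeg_lt); rewrite ler_nat.
rewrite (_ : ex r n F = ex r #|~: [set ord0 : 'I_n.+1]| F); last first.
  by rewrite cardsC1 card_ord.
apply: free_card_le => //; apply: contraNN fH; rewrite has_copyE.
by apply: has_copy_in_sub; apply: subsetT.
Qed.

Lemma ex_addn_le a d : (N <= a)%N ->
  (ex r (a + d) F)%:R <= (ex r a F)%:R + d%:R * (c1 * 'C((a + d).-1, r.-1)%:R).
Proof.
move=> Na; elim: d => [|d IHd]; first by rewrite addn0 mul0r addr0.
rewrite addnS /= -natr1 mulrDl mul1r addrA.
apply: le_trans (ex_succ_le (a + d) _) _; first by lia_nat.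
rewrite lerD2r; apply: le_trans IHd _; rewrite lerD2l.
by rewrite !ler_wpM2l ?ler_nat ?leq_bin2l ?leq_pred.
Qed.

(** Deleting [X] costs [v] at most [#|X| * 'C(n.-2, r.-2)] edges and [H] at most
    [#|X| * 'C(n.-1, r.-1)]. Both losses fit into the slack [delta], so boundedness applies to what
    remains. *)
Lemma has_copy_in_compl n (H : {set {set 'I_n}}) (X : {set 'I_n}) v (delta : R) :
  uniform r H -> delta <= 1 -> delta <= c2 ->
  (N + #|X| <= n)%N -> (m + #|X| <= n)%N ->
  #|X|%:R * 'C(n.-1, r.-1)%:R <= delta * (ex r n F)%:R ->
  #|X|%:R * 'C(n.-2, r.-2)%:R <= delta * 'C(n.-1, r.-1)%:R ->
  (ex r n F <= #|H|)%N ->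
  v \notin X -> (c1 + delta) * 'C(n.-1, r.-1)%:R <= (deg H v)%:R ->
  has_copy_in F H (~: X).
Proof.
move=> uH d1 d2 NX mX Xex Xdeg exH vX vdeg.
have cX : #|~: X| = (n - #|X|)%N by rewrite cardsCs setCK card_ord.
have [phi_inj phiT] := (@enum_val_inj _ (~: X), enum_val_imset (~: X)).
rewrite -phiT -pull_has_copy //; apply: bdd; first by rewrite cX; lia_nat.
- exact: pull_uniform.
- apply: le_trans (_ : (deg (induced H (~: X)) v)%:R <= _).
    have := deg_induced_ge r H X v uH vX; rewrite card_ord -(ler_nat R) natrD natrM => degX.
    apply: le_trans (_ : c1 * 'C(n.-1, r.-1)%:R <= _); last by lra.
    by rewrite ler_wpM2l // ler_nat leq_bin2l // cX; lia_nat.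
  have vX' : v \in ~: X by rewrite inE.
  have := deg_pull _ phi_inj H (enum_rank_in vX' v).
  rewrite phiT enum_rankK_in // => <-; rewrite ler_nat.
  exact: (bigop.bigmax_sup (enum_rank_in vX' v)).
- rewrite card_pull // phiT.
  have := card_induced_leD H setT X 'C(n.-1, r.-1).
  rewrite induced_setT setTD => /(_ _); rewrite -(ler_nat R) natrD natrM => cH.
  have {}cH : #|H|%:R <= #|induced H (~: X)|%:R + #|X|%:R * 'C(n.-1, r.-1)%:R :> R.
    by apply: cH => u _; have := deg_le r H u uH; rewrite card_ord.
  rewrite -(ler_nat R) in exH.
  apply: le_trans (_ : (1 - delta) * (ex r n F)%:R <= _); last by lra.
  apply: le_trans (_ : (1 - delta) * (ex r #|~: X| F)%:R <= _).
    by rewrite ler_wpM2r ?ler0n // lerD2l lerN2.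
  by rewrite ler_wpM2l ?subr_ge0 // ler_nat ex_mono // cX; lia_nat.
Qed.

(** * Heavy vertices and packings of light vertices *)

Section HeavyVertices.
Context (n t : nat) (delta : R) (H : {set {set 'I_n}}).
Let C : R := 'C(n.-1, r.-1)%:R.
Hypothesis r_ge2 : (2 <= r)%N.
Hypothesis r_le_m : (r <= m)%N.
Hypothesis delta_gt0 : 0 < delta.
Hypothesis delta_c1 : m%:R * c1 + 4 * m%:R * delta <= 1.
Let delta_le1 : delta <= 1.
Proof.
have [h0 h1] := (delta_gt0, delta_c1).
have m1 : 1 <= m%:R :> R by rewrite ler1n; lia_nat.
have mc1 : 0 <= m%:R * c1 by rewrite mulr_ge0.
have md : delta <= m%:R * delta by rewrite ler_peMl // ltW.
lra.
Qed.

Hypothesis delta_c2 : delta <= c2.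
Hypothesis N_le : (N + m * t <= n)%N.
Hypothesis m_le : (m + m * t <= n)%N.
Hypothesis t_ex : (m * t)%:R * C <= delta * (ex r n F)%:R.
Hypothesis t_n : 8 * (m * t)%:R * 'C(n.-2, r.-2)%:R <= delta * C.
Hypothesis uH : uniform r H.
Hypothesis fH : ~~ has_disj_copies t.+1 F H.
Hypothesis H_ge_ex : (ex r n F <= #|H|)%N.
Hypothesis H_ge_join : ('C(n, r) + ex r (n - t) F <= #|H| + 'C(n - t, r))%N.

Definition heavy : {set 'I_n} := [set v | (c1 + delta) * C <= (deg H v)%:R].

(* Besides the vertices already covered, the other vertices of L are deleted too, so that they stay available. *)
Lemma packing_heavy (L : {set 'I_n}) s :
  L \subset heavy -> packing F H s -> [disjoint L & covered s] ->
  (size s + #|L| <= t.+1)%N -> exists2 s', packing F H s' & size s' = (size s + #|L|)%N.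
Proof.
have [k] := ubnP #|L|; elim: k L s => // k IHk L s; rewrite ltnS => Lk Lh ps dis sz.
have [L0|[v vL]] := set_0Vmem L; first by exists s; rewrite // L0 cards0 addn0.
have cL := cardsD1 v L; rewrite vL add1n in cL.
pose X := covered s :|: (L :\ v).
(* Taking [v] out of [L] lowers the bound [t.+1] to [t], and each remaining vertex of [L] counts at
   most [m]. *)
have cX : (#|X| <= m * t)%N.
  apply: leq_trans (leq_card_setU _ _) _.
  have := card_covered s.
  have : (m * size s + #|L :\ v| <= m * t)%N.
    have : (m * (size s + #|L :\ v|) <= m * t)%N by rewrite leq_mul2l; apply/orP; right; lia_nat.
    rewrite mulnDr; have : (#|L :\ v| <= m * #|L :\ v|)%N by rewrite leq_pmull //; lia_nat.
    lia_nat.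
  lia_nat.
have vX : v \notin X.
  rewrite !inE eqxx orbF; apply: contraTN dis => vs.
  by apply/pred0Pn; exists v; rewrite /= vL.
have cXR : #|X|%:R <= (m * t)%:R :> R by rewrite ler_nat.
have /existsP[f /andP[cf fX]] : has_copy_in F H (~: X).
  apply: (has_copy_in_compl n H X v delta) => //; try lia_nat.
  - by apply: le_trans t_ex; rewrite ler_wpM2r ?ler0n.
  - apply: le_trans t_n; rewrite ler_wpM2r ?ler0n //.
    by have mt := ler0n R (m * t); lra.
  - by have := subsetP Lh v vL; rewrite inE.
have [fs fL] : [disjoint f @: setT & covered s] /\ [disjoint f @: setT & L :\ v].
  by move: fX; rewrite -disjoints_subset -!setI_eq0 setIUr setU_eq0 => /andP.
have [] := IHk (L :\ v) (f :: s).
- lia_nat.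
- by apply: subset_trans Lh; apply: subsetDl.
- exact: packing_cons.
- rewrite covered_cons -setI_eq0 setIUr setU_eq0 !setI_eq0 disjoint_sym fL /=.
  by apply: disjointWl dis; apply: subsetDl.
- by rewrite /= addSnnS -cL.
by move=> s' ps' ss'; exists s'; rewrite // ss' /= addSnnS -cL.
Qed.

Lemma card_heavy_le : (#|heavy| <= t)%N.
Proof.
rewrite leqNgt; apply: contraNN fH => big.
have [L Lh cL] : exists2 L : {set 'I_n}, L \subset heavy & #|L| = t.+1.
  have : (0 < #|[set A : {set 'I_n} | (A \subset heavy) & (#|A| == t.+1)]|)%N.
    by rewrite cards_draws bin_gt0.
  by case/card_gt0P=> L; rewrite inE => /andP[Lh /eqP cL]; exists L.
have [] := packing_heavy L [::] Lh.
- by [].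
- by rewrite /covered big_nil -setI_eq0 setI0.
- by rewrite cL.
by move=> s ps ss; rewrite -cL -[#|L|]add0n -ss packing_has_disj_copies.
Qed.

Lemma maximal_packing_light : exists s,
  [/\ packing F H s, [disjoint heavy & covered s], (size s + #|heavy| <= t)%N &
      ~~ has_copy_in F H (~: heavy :\: covered s)].
Proof.
set goal := (exists s, _); have ht := card_heavy_le.
(* A light packing grows until it is maximal. At size [t.+1 - #|heavy|], one further copy per heavy
   vertex would make [t.+1] disjoint copies. *)
suff search j : (j <= t.+1 - #|heavy|)%N -> goal \/ exists s,
    [/\ packing F H s, [disjoint heavy & covered s] & size s = j].
  have [//|[s [ps dis sz]]] := search _ (leqnn _).
  have [|s' ps' ss'] := packing_heavy heavy s (subxx _) ps dis; first by lia_nat.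
  case/negP: fH; rewrite (_ : t.+1 = size s') ?packing_has_disj_copies //; lia_nat.
elim: j => [_|j IHj jt].
  by right; exists [::]; rewrite /covered big_nil -setI_eq0 setI0.
have [|IH|[s [ps dis sz]]] := IHj; [lia_nat | by left |].
case: (boolP (has_copy_in F H (~: heavy :\: covered s))) => [|max_s]; last first.
  by left; exists s; split=> //; lia_nat.
case/existsP=> f /andP[cf]; rewrite subsetD -disjoints_subset => /andP[fh fs].
right; exists (f :: s); split; [exact: packing_cons | | by rewrite /= sz].
by rewrite covered_cons -setI_eq0 setIUr setU_eq0 !setI_eq0 disjoint_sym fh.
Qed.

Lemma light_free : #|heavy| = t /\ ~~ has_copy_in F H (~: heavy).
Proof.
have [s [ps dis sz free]] := maximal_packing_light.
have [tl|lt_t] := leqP t #|heavy|.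
  have s0 : s = [::].
    case: s sz {ps dis free} => //= f s sz.
    by have := leq_trans sz tl; rewrite ltnNge leq_addl.
  move: free sz; rewrite s0 /covered big_nil setD0 add0n => -> sz; split=> //.
  by apply/eqP; rewrite eqn_leq sz.
(* Here [d] heavy vertices are missing. The edges are split into those meeting [heavy], those that
   meet [covered s] only, and the rest; the total is compared with the join. *)
exfalso; set d := (t - #|heavy|)%N.
have d_gt0 : (0 < d)%N by rewrite subn_gt0.
have bmd : (#|covered s| <= m * d)%N.
  by apply: leq_trans (card_covered s) _; rewrite leq_mul2l; apply/orP; right; lia_nat.
have dmd : (d <= m * d)%N by rewrite leq_pmull //; lia_nat.
have lt_mt : (#|heavy| <= m * #|heavy|)%N by rewrite leq_pmull //; lia_nat.
have dt : (m * d + m * #|heavy| = m * t)%N by rewrite -mulnDr subnK // ltnW.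
set b := #|covered s| in bmd *.
have tmt : (t <= m * t)%N by rewrite leq_pmull //; lia_nat.
have cS : #|~: heavy| = (n - #|heavy|)%N by rewrite cardsCs setCK card_ord.
have cS' : #|~: heavy :\: covered s| = (n - #|heavy| - b)%N.
  rewrite cardsDS ?cS //; apply: (subset_trans _ (subxx _)).
  by rewrite -disjoints_subset disjoint_sym.
(* The uncovered light part has [n - t + d - b] vertices. If this exceeds [n - t], each extra vertex
   costs at most [c1 * C]; otherwise [d - b] truncates to 0. *)
have ex_light : (ex r #|~: heavy :\: covered s| F)%:R <=
    (ex r (n - t) F)%:R + (d - b)%N%:R * (c1 * C).
  rewrite cS'; have [bd|db] := leqP b d.
    have -> : (n - #|heavy| - b = (n - t) + (d - b))%N by lia_nat.
    apply: le_trans (ex_addn_le _ _ _) _; first by lia_nat.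
    by rewrite lerD2l !ler_wpM2l ?ler0n // ler_nat leq_bin2l //; lia_nat.
  rewrite (_ : d - b = 0)%N ?mul0r ?addr0 ?ler_nat ?ex_mono //; lia_nat.
have sum_light : (\sum_(v in covered s) deg H v)%N%:R <= b%:R * ((c1 + delta) * C).
  rewrite natr_sum mulr_natl -sumr_const; apply: ler_sum => v vs.
  apply/ltW; rewrite ltNge; apply: contraTN dis => vh; apply/pred0Pn; exists v.
  by rewrite /= vs inE vh.
have meet := card_meeting_le r H (~: heavy) uH.
rewrite card_ord cS in meet.
have split := card_induced_le_sum H (~: heavy) (covered s).
have bound := free_card_le F r H _ uH free.
have binS : ('C(n - t, r) + d * 'C(n - t, r.-1) <= 'C(n - #|heavy|, r))%N.
  have -> : (n - #|heavy| = (n - t) + d)%N by lia_nat.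
  by rewrite -(prednK (ltnW r_ge2)) bin_addn_ge.
(* With [tC], passing from [n.-1] to [n - t] loses at most the fraction [delta / 8] of [C]. *)
have C_le : C <= 'C(n - t, r.-1)%:R + t%:R * 'C(n.-2, r.-2)%:R.
  rewrite -natrM -natrD ler_nat.
  have -> : (n.-1 = (n - t) + t.-1)%N by lia_nat.
  have -> : (r.-1 = r.-2.+1)%N by lia_nat.
  apply: leq_trans (bin_addn_le _ _ _) _; rewrite leq_add2l.
  have -> : ((n - t + t.-1).-1 = n.-2)%N by lia_nat.
  by rewrite leq_mul2r leq_pred orbT.
have tC : t%:R * 'C(n.-2, r.-2)%:R <= delta / 8 * C.
  have [h1 h2] : t%:R * 'C(n.-2, r.-2)%:R <= (m * t)%:R * 'C(n.-2, r.-2)%:R :> R /\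
      8 * (m * t)%:R * 'C(n.-2, r.-2)%:R <= delta * C.
    by split; last exact: t_n; rewrite ler_wpM2r ?ler_nat.
  lra.
have C_gt0 : 0 < C by rewrite ltr0n bin_gt0; lia_nat.
have edges : d%:R * 'C(n - t, r.-1)%:R <= (d - b)%N%:R * (c1 * C) + b%:R * ((c1 + delta) * C).
  have : ('C(n, r) + ex r (n - t) F + d * 'C(n - t, r.-1) <=
    'C(n, r) + (ex r #|~: heavy :\: covered s| F + \sum_(v in covered s) deg H v))%N by lia_nat.
  by rewrite -(ler_nat R) !natrD natrM => total; lra.
(* With truncation, the left side is the maximum of [d] and [b]. *)
have max_le : (d - b)%N%:R + b%:R <= m%:R * d%:R :> R.
  by rewrite -natrD -natrM ler_nat; lia_nat.
have [[del0 c0] mc] := (delta_gt0, c1_ge0, delta_c1).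
have m1 : 1 <= m%:R :> R by rewrite ler1n; lia_nat.
have dR : 0 < d%:R :> R by rewrite ltr0n.
have md : delta <= m%:R * delta by rewrite ler_peMl // ltW.
(* Up to the factor [d * C], the products below give [1 - delta / 8 <= m * (c1 + delta) <= 1 - 3 * m
   * delta], which is absurd as [m >= 1]. *)
have h1 : (d - b)%N%:R * (c1 * C) <= (d - b)%N%:R * ((c1 + delta) * C).
  by rewrite ler_wpM2l ?ler0n // ler_pM2r //; lra.
have h2 : ((d - b)%N%:R + b%:R) * ((c1 + delta) * C) <= m%:R * d%:R * ((c1 + delta) * C).
  by rewrite ler_wpM2r // mulr_ge0 ?ltW //; lra.
have h3 : d%:R * C * (m%:R * c1 + 4 * m%:R * delta) <= d%:R * C * 1.
  by rewrite ler_pM2l ?mulr_gt0.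
have h4 : d%:R * (C - delta / 8 * C) <= d%:R * 'C(n - t, r.-1)%:R.
  by rewrite ler_pM2l //; lra.
have h5 : d%:R * C * delta <= d%:R * C * (m%:R * delta) by rewrite ler_pM2l ?mulr_gt0.
have h6 : 0 < d%:R * C * delta by rewrite !mulr_gt0.
have : d%:R * C * delta <= 0 by lra.
by rewrite leNgt h6.
Qed.

End HeavyVertices.
End Bounded.


(** * Extremal graphs and the join construction *)

Section Extremal.
Local Open Scope nat_scope.
Context {m r : nat} (F : {set {set 'I_m}}).

Lemma exk_ge {n k : nat} (H : {set {set 'I_n}}) :
  uniform r H -> ~~ has_disj_copies k F H -> #|H| <= exk r n k F.
Proof. by move=> uH fH; apply: (bigop.bigmax_sup H); rewrite ?uH. Qed.

Lemma exk_attained {n k : nat} (H0 : {set {set 'I_n}}) :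
  uniform r H0 -> ~~ has_disj_copies k F H0 ->
  exists H : {set {set 'I_n}}, isEXk r k F H.
Proof.
move=> u0 f0; have P0 : uniform r H0 && ~~ has_disj_copies k F H0 by rewrite u0.
rewrite /isEXk /exk (bigop.bigmax_eq_arg H0) //.
case: arg_maxnP => // H /andP[u f] _; by exists H; rewrite u f eqxx.
Qed.

Lemma ex_le_exk n k : ex r n F <= exk r n k.+1 F.
Proof.
case: (posnP (ex r n F)) => [->//|/ex_gt0_attained[G /and3P[uG fG /eqP <-]]].
by apply: exk_ge uG _; apply: contraNN fG; apply: has_disj_copies_has_copy.
Qed.

Lemma card_compl_imset n t (phi : 'I_(n - t) -> 'I_n) :
  injective phi -> t <= n -> #|~: (phi @: setT)| = t.
Proof. by move=> phi_inj tn; rewrite cardsCs setCK card_imset // cardsT !card_ord subKn. Qed.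

Lemma exk_ge_join n t (G : {set {set 'I_(n - t)}}) : t <= n -> isEX r F G ->
  'C(n, r) + ex r (n - t) F <= exk r n t.+1 F + 'C(n - t, r).
Proof.
move=> tn /and3P[uG fG /eqP <-].
have phi_inj : injective (widen_ord (leq_subr t n)) by move=> i j /(congr1 val) /= /val_inj.
have := card_join_along r _ phi_inj G uG; rewrite !card_ord => <-; rewrite leq_add2r.
apply: exk_ge; first exact: join_along_uniform.
by apply: join_along_free => //; rewrite card_compl_imset.
Qed.

(* H is contained in the join of K_t with its part outside L, and extremality forces equality. *)
Lemma isEXk_join n t (H : {set {set 'I_n}}) (L : {set 'I_n}) :
  isEXk r t.+1 F H -> #|L| = t -> ~~ has_copy_in F H (~: L) ->
  exists G : {set {set 'I_(n - t)}}, isEX r F G /\ isomorphic (joinK r t G) H.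
Proof.
move=> /and3P[uH fH /eqP cH] cL free.
have tn : t <= n by rewrite -cL -[leqRHS]card_ord max_card.
have cS : n - t = #|~: L| by rewrite cardsCs setCK card_ord cL.
pose phi (i : 'I_(n - t)) := enum_val (cast_ord cS i).
have phi_inj : injective phi by move=> i j /enum_val_inj/cast_ord_inj.
have phiT : phi @: setT = ~: L.
  rewrite -(enum_val_imset (~: L)); apply/setP=> v.
  apply/imsetP/imsetP => -[i _ ->]; first by exists (cast_ord cS i).
  by exists (cast_ord (esym cS) i); rewrite // /phi cast_ordKV.
pose G := pull phi H.
have uG : uniform r G by apply: pull_uniform.
have fG : ~~ has_copy F G by rewrite pull_has_copy ?phiT.
have [G' exG'] := ex_attained F r G uG fG.
have leG : #|G| <= ex r (n - t) F by apply: (bigop.bigmax_sup G); rewrite ?uG.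
(* [#|H|] lies between the size of a join with an extremal graph and that of the join with [G];
   hence [G] is extremal and [H] fills its join. *)
have := exk_ge_join n t G' tn exG'; rewrite -cH => geH.
have sub := sub_join_along_pull r phi H uH.
have := card_join_along r phi phi_inj G uG; rewrite !card_ord => cJ.
exists G; split.
  by rewrite /isEX uG fG eqn_leq leG -(leq_add2l 'C(n, r)) -cJ (leq_trans geH) // leq_add2r subset_leq_card.
apply/isomorphic_joinK; first by rewrite card_ord subnKC.
exists phi; split=> //; apply/eqP; rewrite eqEcard sub.
by rewrite -(leq_add2r 'C(n - t, r)) cJ (leq_trans _ geH) // leq_add2l leG.
Qed.

End Extremal.

(** * From the constants of the theorem to the characterization *)

(** The range of [t] is turned into the hypotheses of [light_free]; [L] is the set of heavy
    vertices, or empty if [t = 0]. *)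
Lemma light_complement (R : realType) (m r : nat) (F : {set {set 'I_m}}) (c1 c2 : R) :
  (2 <= r)%N -> (r <= m)%N ->
  bounded r F c1 c2 -> c1 < 1 / m%:R -> 0 < c2 ->
  let delta := Num.min ((1 / 4) * (1 / m%:R - c1)) (c2 / 4) in
  exists n0 : nat, forall n : nat, (n0 <= n)%N ->
    forall t : nat,
      t%:R <= delta * (ex r n F)%:R / ((m * 'C(n.-1, r.-1))%N)%:R ->
      t%:R <= delta * (n%:R - 1) / ((8 * m * (r - 1))%N)%:R ->
      (t <= n)%N /\ forall H : {set {set 'I_n}}, isEXk r t.+1 F H ->
        exists2 L : {set 'I_n}, #|L| = t & ~~ has_copy_in F H (~: L).
Proof.
move=> r2 rm [N bdd] c1m c2_gt0 delta.
(* The factor 2 leaves half of [n] for [m * t], which [mt_le] bounds by an eighth of [n.-1]. *)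
exists (2 * (N + m))%N => n n_ge t t_ex t_n.
have m_gt0 : (0 < m)%N by lia_nat.
have mR : 0 < m%:R :> R by rewrite ltr0n.
case: (posnP t) => [t0|t_gt0].
  rewrite t0; split=> // H /and3P[_ fH _]; exists set0; rewrite ?cards0 // setC0 -has_copyE.
  apply: contraNN fH => /existsP[f cf]; apply: (packing_has_disj_copies F H [:: f]).
  by rewrite /packing /= andbT [is_copy _ _ _]cf.
have C_gt0 : (0 < 'C(n.-1, r.-1))%N by rewrite bin_gt0; lia_nat.
have mc1 : m%:R * c1 < 1 by move: c1m; rewrite ltr_pdivlMr // mulrC.
have delta_gt0 : 0 < delta.
  by rewrite lt_min; apply/andP; split; lra.
have delta_c2 : delta <= c2.
  have : delta <= c2 / 4 by rewrite ge_min lexx orbT.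
  lra.
have delta_c1 : m%:R * c1 + 4 * m%:R * delta <= 1.
  have : delta <= (1 / 4) * (1 / m%:R - c1) by rewrite ge_min lexx.
  rewrite -(ler_pM2l mR) => le_d.
  have mV : m%:R * (1 / m%:R) = 1 :> R by rewrite mul1r divff // gt_eqF.
  lra.
have ex_gt0 : (0 < ex r n F)%N.
  rewrite lt0n; apply/eqP=> ex0; move: t_ex; rewrite ex0 mulr0 mul0r.
  by rewrite leNgt ltr0n t_gt0.
(* A negative [c1] would make the degree condition vacuous, so an extremal graph would contain
   [F]. *)
have c1_ge0 : 0 <= c1.
  have [G /and3P[uG fG /eqP cG]] := ex_gt0_attained F r n ex_gt0.
  rewrite leNgt; apply: contraNN fG => c1_lt0; apply: bdd => //; first by lia_nat.
    by apply: (@le_trans _ _ 0) => //; rewrite mulr_le0_ge0 // ltW.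
  by rewrite cG mulrBl mul1r gerBl mulr_ge0 // ltW.
have t_ex' : (m * t)%:R * 'C(n.-1, r.-1)%:R <= delta * (ex r n F)%:R.
  move: t_ex; rewrite ler_pdivlMr ?ltr0n ?muln_gt0 ?m_gt0 //; apply: le_trans.
  by rewrite -!natrM ler_nat mulnCA mulnA.
have t_n' : 8 * (m * t)%:R * (r - 1)%N%:R <= delta * (n%:R - 1).
  move: t_n; rewrite ler_pdivlMr; last by rewrite ltr0n !muln_gt0 m_gt0 subn_gt0.
  by apply: le_trans; rewrite -!natrM ler_nat; lia_nat.
have nR : n%:R - 1 = (n.-1)%:R :> R by rewrite -subn1 natrB //; lia_nat.
have n1_gt0 : 0 < (n.-1)%:R :> R by rewrite ltr0n; lia_nat.
rewrite nR in t_n'.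
(* After multiplication by [n.-1], this follows from [t_n'] and [n.-1 * 'C(n.-2, r.-2) = r.-1 *
   'C(n.-1, r.-1)]. *)
have t_n2 : 8 * (m * t)%:R * 'C(n.-2, r.-2)%:R <= delta * 'C(n.-1, r.-1)%:R.
  rewrite -(ler_pM2l n1_gt0).
  have /(congr1 (fun k => k%:R : R)) := mul_bin_diag n.-1 r.-2.
  rewrite !natrM (_ : r.-2.+1 = r.-1); last by lia_nat.
  move=> diag; rewrite mulrCA diag.
  have := ler_wpM2r (ler0n R 'C(n.-1, r.-1)) t_n'; rewrite subn1 => bound; lra.
have mt_le : (8 * (m * t) <= n.-1)%N.
  have m1 : 1 <= m%:R :> R by rewrite ler1n.
  have mc1_ge0 : 0 <= m%:R * c1 by rewrite mulr_ge0.
  have md : delta <= m%:R * delta by rewrite ler_peMl // ltW.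
  have d1 : delta <= 1 by lra.
  rewrite -(ler_nat R); apply: le_trans (_ : delta * (n.-1)%:R <= _).
    apply: le_trans t_n'; rewrite natrM ler_peMr ?mulr_ge0 // ler1n; lia_nat.
  by rewrite ler_piMl ?ler0n.
have tmt : (t <= m * t)%N by rewrite leq_pmull.
have tn : (t <= n)%N by lia_nat.
split=> // H EXH; have [uH fH /eqP cH] := and3P EXH.
(* If [F] had no edges, any injection of its vertices would be a copy. As it has one, the empty
   graph on [n - t] vertices is [F]-free. *)
have F_neq0 : F != set0.
  have [G /and3P[_ fG _]] := ex_gt0_attained F r n ex_gt0.
  have mn : (m <= n)%N by lia_nat.
  apply: contraNneq fG => ->; apply/existsP; exists [ffun i => widen_ord mn i].
  apply/andP; split; last by apply/forall_inP=> e; rewrite inE.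
  by apply/injectiveP=> i j; rewrite !ffunE => /(congr1 val) /= /val_inj.
have [G exG] : exists G : {set {set 'I_(n - t)}}, isEX r F G.
  apply: (ex_attained F r set0); first by apply/uniformP=> e; rewrite inE.
  apply/existsP=> -[f /andP[_ /forall_inP Ff]].
  by have [e /Ff] := set0Pn _ F_neq0; rewrite inE.
have Nmt : (N + m * t <= n)%N by lia_nat.
have mmt : (m + m * t <= n)%N by lia_nat.
have exH : (ex r n F <= #|H|)%N by rewrite cH ex_le_exk.
have joinH : ('C(n, r) + ex r (n - t) F <= #|H| + 'C(n - t, r))%N.
  by rewrite cH; apply: exk_ge_join exG.
have [cL fL] := light_free F N c1_ge0 c2_gt0 bdd n t delta H r2 rm delta_gt0 delta_c1
  delta_c2 Nmt mmt t_ex' t_n2 uH fH exH joinH.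
by exists (heavy n delta H (r := r) (c1 := c1)).
Qed.

Theorem theorem1p7 (R : realType) (m r : nat) (F : {set {set 'I_m}}) (c1 c2 : R) :
  (2 <= r)%N -> (r <= m)%N -> uniform r F ->
  bounded r F c1 c2 -> c1 < 1 / m%:R -> 0 < c2 ->
  let delta := Num.min ((1 / 4) * (1 / m%:R - c1)) (c2 / 4) in
  exists n0 : nat, forall n : nat, (n0 <= n)%N ->
    forall t : nat,
      t%:R <= delta * (ex r n F)%:R / ((m * 'C(n.-1, r.-1))%N)%:R ->
      t%:R <= delta * (n%:R - 1) / ((8 * m * (r - 1))%N)%:R ->
      forall H : {set {set 'I_n}},
        isEXk r t.+1 F H <->
        exists G : {set {set 'I_(n - t)}}, isEX r F G /\ isomorphic (joinK r t G) H.
Proof.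
move=> r2 rm _ bdd c1m c2_gt0 delta.
have [n0 main] := light_complement R m r F c1 c2 r2 rm bdd c1m c2_gt0.
exists n0 => n n_ge t t_ex t_n H; have [tn {}main] := main n n_ge t t_ex t_n.
have cV : #|'I_n| = (t + (n - t))%N by rewrite card_ord subnKC.
(* All joins with extremal graphs have the same number of edges. *)
have join_props (G : {set {set 'I_(n - t)}}) (H' : {set {set 'I_n}}) :
    isEX r F G -> isomorphic (joinK r t G) H' ->
    [/\ uniform r H', ~~ has_disj_copies t.+1 F H' &
        (#|H'| + 'C(n - t, r) = 'C(n, r) + ex r (n - t) F)%N].
  move=> /and3P[uG fG /eqP <-] /(isomorphic_joinK r t (n - t) G H' cV)[phi [phi_inj ->]].
  split; first exact: join_along_uniform.
    by apply: join_along_free => //; rewrite card_compl_imset.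
  by have := card_join_along r phi phi_inj G uG; rewrite !card_ord.
split=> [EXH|[G [EXG isoH]]].
  by have [L cL fL] := main H EXH; apply: isEXk_join EXH cL fL.
have [uH fH cH] := join_props G H EXG isoH.
(* Some extremal [H0] exists and is itself such a join, so [H] has as many edges as [H0]. *)
have [H0 EXH0] := exk_attained F H uH fH.
have [L cL fL] := main H0 EXH0.
have [G0 [EXG0 isoH0]] := isEXk_join F n t H0 L EXH0 cL fL.
have [_ _ cH0] := join_props G0 H0 EXG0 isoH0.
have /and3P[_ _ /eqP cE] := EXH0.
by rewrite /isEXk uH fH -cE -(eqn_add2r 'C(n - t, r)) cH cH0 eqxx.
Qed.
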